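(* Let $n\ge 2$, let $y=(y_1,\dots,y_n)^T\in\mathbb{R}^n$, and let $y_{(1)}\le y_{(2)}\le\cdots\le y_{(n)}$ denote the components of $y$ sorted in ascending order. Let $f:\mathbb{R}\to\mathbb{R}$ be the function defined by $$f(t)=\begin{cases} t+\dfrac12\displaystyle\sum_{j=1}^n (t-y_j)^2 & \text{if } t\le y_{(1)},\\[2mm] t+\dfrac12\displaystyle\sum_{j=i+1}^n (t-y_{(j)})^2 & \text{if } y_{(i)}\le t\le y_{(i+1)},\ i=1,\dots,n-1,\\[2mm] t+\dfrac12 (t-y_{(n)})^2 & \text{if } t\ge y_{(n)}.\end{cases}$$ Then $f$ is continuous on $\mathbb{R}$, and its derivative $f'$ exists and is also continuous on $\mathbb{R}$.
   Context: The cases in the definition of $f$ overlap at the points $y_{(1)},\dots,y_{(n)}$; the function $f$ is well defined because the formulas agree at these points. *)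

(* Defs.v *)
From mathcomp Require Import all_boot all_order all_algebra.
From mathcomp Require Import all_classical all_reals all_analysis.
Set Implicit Arguments.
Unset Strict Implicit.
Unset Printing Implicit Defensive.
Import Order.TTheory GRing.Theory Num.Theory.
Import numFieldNormedType.Exports.
Local Open Scope ring_scope.

(* [ostat y i] is y_(i), numbered from 1 to n as on paper. *)
Definition ostat (R : realType) (n : nat) (y : 'cV[R]_n) (i : nat) : R :=
  nth 0 (sort <=%O [seq y j 0 | j <- enum 'I_n]) i.-1.

(* The index i : 'I_n with 0 < i ranges over 1, ..., n-1. At points where
   several cases apply the choice is immaterial: [pwfun_left], [pwfun_mid] and
   [pwfun_right] give each formula on the whole closed range of its case. By
   [pwfun_cover] the last branch is only reached when y_(n) <= t. *)
Definition pwfun (R : realType) (n : nat) (y : 'cV[R]_n) (t : R) : R :=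
  if t <= ostat y 1 then t + 2^-1 * \sum_(j < n) (t - y j 0) ^+ 2
  else if [pick i : 'I_n | (0 < i)%N && (ostat y i <= t <= ostat y i.+1)]
       is Some i
  then t + 2^-1 * \sum_(i.+1 <= j < n.+1) (t - ostat y j) ^+ 2
  else t + 2^-1 * (t - ostat y n) ^+ 2.

Lemma ostat_le (R : realType) (n : nat) (y : 'cV[R]_n) (i j : nat) :
  (0 < i)%N -> (i <= j <= n)%N -> ostat y i <= ostat y j.
Proof.
move=> i0 /andP[ij jn]; rewrite /ostat.
set s := sort _ _.
have sz : size s = n by rewrite size_sort size_map size_enum_ord.
apply: (sorted_leq_nth le_trans le_refl 0 (sort_le_sorted _)).
- by rewrite inE -/s sz (leq_trans _ jn)// prednK// (leq_trans i0).
- by rewrite inE -/s sz prednK// (leq_trans i0).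
- by rewrite -!subn1 leq_sub2r.
Qed.

Lemma sum_ostat (R : realType) (n : nat) (y : 'cV[R]_n) (F : R -> R) :
  \sum_(j < n) F (y j 0) = \sum_(1 <= j < n.+1) F (ostat y j).
Proof.
rewrite big_add1 /= /ostat /=.
set s := sort _ _.
have sz : size s = n by rewrite size_sort size_map size_enum_ord.
have -> : \sum_(0 <= j < n) F s`_j = \sum_(x <- s) F x.
  by rewrite [RHS](big_nth 0) sz.
have /permPl/(perm_big _) -> : perm_eql s [seq y j 0 | j <- enum 'I_n].
  exact: perm_sort.
by rewrite big_map big_enum.
Qed.

Lemma tail_sum_eq (R : realType) (n : nat) (y : 'cV[R]_n) (t : R) (i k : nat) :
  (i <= k)%N -> (k <= n)%N -> t <= ostat y i.+1 -> ostat y k <= t ->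
  \sum_(i.+1 <= j < n.+1) (t - ostat y j) ^+ 2 =
  \sum_(k.+1 <= j < n.+1) (t - ostat y j) ^+ 2.
Proof.
move=> ik kn ti kt; rewrite (@big_cat_nat _ _ _ k.+1)//= big_nat big1 ?add0r//.
move=> j /andP[ij jk]; suff -> : ostat y j = t by rewrite subrr expr0n.
apply/le_anti/andP; split.
- by apply: le_trans kt; apply: ostat_le; rewrite ?(leq_trans _ ij)// -ltnS jk.
- by apply: (le_trans ti); apply: ostat_le; rewrite // ij (leq_trans _ kn).
Qed.

Lemma pwfun_left (R : realType) (n : nat) (y : 'cV[R]_n) (t : R) :
  t <= ostat y 1 -> pwfun y t = t + 2^-1 * \sum_(j < n) (t - y j 0) ^+ 2.
Proof. by rewrite /pwfun => ->. Qed.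

Lemma pwfun_mid (R : realType) (n : nat) (y : 'cV[R]_n) (t : R) (i : nat) :
  (1 <= i <= n.-1)%N -> ostat y i <= t <= ostat y i.+1 ->
  pwfun y t = t + 2^-1 * \sum_(i.+1 <= j < n.+1) (t - ostat y j) ^+ 2.
Proof.
move=> /andP[i0 iltn] /andP[it ti].
have ni : (i < n)%N by case: n y iltn it ti => [|n] y //= ; case: i i0.
rewrite /pwfun; case: ifPn => [t1|_].
  rewrite (sum_ostat y (fun x => (t - x) ^+ 2)); congr (_ + _ * _).
  by apply: tail_sum_eq => //; exact: ltnW.
case: pickP => [k /and3P[k0 kt tk]|/(_ (Ordinal ni))]; last first.
  by rewrite /= i0 it ti.
congr (_ + _ * _); have [ik|/ltnW ki] := leqP i k.
  by apply/esym/tail_sum_eq => //; exact: ltnW.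
by apply: tail_sum_eq => //; exact: ltnW.
Qed.

Lemma pwfun_right (R : realType) (n : nat) (y : 'cV[R]_n) (t : R) :
  (2 <= n)%N -> ostat y n <= t ->
  pwfun y t = t + 2^-1 * (t - ostat y n) ^+ 2.
Proof.
case: n y => [//|[//|n]] y _ nt.
have n1t : ostat y n.+1 <= t.
  by apply: le_trans nt; apply: ostat_le => //; rewrite leqnSn leqnn.
have -> : (t - ostat y n.+2) ^+ 2 =
    \sum_(n.+2 <= j < n.+3) (t - ostat y j) ^+ 2 by rewrite big_nat1.
rewrite /pwfun; case: ifPn => [t1|_].
  rewrite (sum_ostat y (fun x => (t - x) ^+ 2)); congr (_ + _ * _).
  exact: tail_sum_eq.
case: pickP => [k /and3P[k0 kt tk]|_]; last by rewrite big_nat1.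
congr (_ + _ * _); apply: tail_sum_eq => //.
by rewrite -ltnS.
Qed.

Lemma pwfun_cover (R : realType) (n : nat) (y : 'cV[R]_n) (t : R) :
  (2 <= n)%N ->
  [\/ t <= ostat y 1,
      exists2 i : nat, (1 <= i <= n.-1)%N & ostat y i <= t <= ostat y i.+1
    | ostat y n <= t].
Proof.
case: n y => [//|[//|n]] y _ /=.
have [|t1] := leP t (ostat y 1); first by constructor 1.
have [|tn] := leP (ostat y n.+2) t; first by constructor 3.
constructor 2.
have ex : exists k, t <= ostat y k.+1 by exists n.+1; exact: ltW.
case: (ex_minnP ex) => -[|k] tk kmin; first by rewrite leNgt t1 in tk.
exists k.+1; first by rewrite /= (kmin n.+1 (ltW tn)).
rewrite tk andbT leNgt; apply/negP => /ltW /kmin.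
by rewrite ltnn.
Qed.

(* Main.v *)
Require Import Defs.
From mathcomp Require Import all_boot all_order all_algebra.
From mathcomp Require Import all_classical all_reals all_analysis.
From mathcomp Require Import ring lra.
Import Order.TTheory GRing.Theory Num.Theory.
Import numFieldNormedType.Exports.
Local Open Scope classical_set_scope.
Local Open Scope ring_scope.

(** From [y_(n-1)] on, [f t = t + (t - y_(n))^2 / 2]: the last two formulas
    agree. Each [y_(j)] with [j < n] contributes only to the left of [y_(j)], so
    [f t = t + ((t - y_(n))^2 + \sum_(1 <= j < n) min(t - y_(j), 0)^2) / 2]
    on the whole line, and [min(x, 0)^2] has the continuous derivative
    [2 min(x, 0)]. *)

(** For all [x] and [h], [|min(x + h, 0)^2 - min(x, 0)^2 - 2 h min(x, 0)| <= h^2]. The difference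
    quotient is thus squeezed within [|h|] of the limit, with no separate treatment of the kink at
    0. *)
Lemma is_derive_sqr_min0 (R : realType) (x : R) :
  is_derive x 1 (fun t : R => Num.min t 0 ^+ 2) (2 * Num.min x 0).
Proof.
set f := fun t : R => Num.min t 0 ^+ 2.
have norm0 : `|h| @[h --> (0 : R)^'] --> (0 : R).
  by rewrite -[X in _ --> X](normr0 R); apply: cvg_norm; exact: cvg_within.
have cst0 (c : R) : c @[_ --> (0 : R)^'] --> c by exact: cvg_cst.
have quot : h^-1 *: ((f \o shift x) (h *: 1) - f x) @[h --> (0 : R)^']
    --> 2 * Num.min x 0.
  apply: (@squeeze_cvgr _ _ _ _ (fun h : R => 2 * Num.min x 0 - `|h|)
    (fun h : R => 2 * Num.min x 0 + `|h|)); last 2 first.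
  - by rewrite -[X in _ --> X]subr0; exact: cvgB (cst0 _) norm0.
  - by rewrite -[X in _ --> X]addr0; exact: cvgD (cst0 _) norm0.
  near=> h; have h0 : h != 0 by near: h; exact: nbhs_dnbhs_neq.
  rewrite -ler_distl /= /f /shift /= /GRing.scale /= mulr1.
  (* Multiplying by [|h|] clears [h^-1]; a polynomial inequality remains for each choice of signs of
     [h + x] and [x]. *)
  rewrite -(ler_pM2l (x := `|h|)) ?normr_gt0// -!normrM mulrBr mulrA divff//.
  rewrite mul1r -expr2 (ger0_norm (sqr_ge0 h)) ler_norml.
  by case: (lerP (h + x) 0) => ?; case: (lerP x 0) => ?; apply/andP; split; nra.
split; first by apply/cvg_ex; exists (2 * Num.min x 0).
exact: cvg_lim quot.
Unshelve. all: by end_near. Qed.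

Section closed_form.
Context {R : realType} {n : nat} (y : 'cV[R]_n).

Definition pwfun_closed (t : R) : R :=
  t + 2^-1 * ((t - ostat y n) ^+ 2 +
              \sum_(j < n.-1) Num.min (t - ostat y j.+1) 0 ^+ 2).

Definition pwfun_slope (t : R) : R :=
  1 + ((t - ostat y n) + \sum_(j < n.-1) Num.min (t - ostat y j.+1) 0).

(** The minimum vanishes for [j <= i] and equals [t - y_(j)] for [i < j < n]. The term of [y_(n)] is
    split off, so [t] may lie on either side of [y_(n)]. The cuts [i = 0] and [i = n - 1] serve the
    two outer formulas of [f]. *)
Lemma tail_sum_min (t : R) (i : nat) : (i < n)%N ->
  (forall j, (0 < j <= i)%N -> ostat y j <= t) ->
  (forall j, (i < j < n)%N -> t <= ostat y j) ->
  \sum_(i.+1 <= j < n.+1) (t - ostat y j) ^+ 2 =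
  (t - ostat y n) ^+ 2 + \sum_(j < n.-1) Num.min (t - ostat y j.+1) 0 ^+ 2.
Proof.
move=> ni lo hi; rewrite big_nat_recr//= addrC; congr (_ + _).
rewrite -(big_mkord xpredT (fun j => Num.min (t - ostat y j.+1) 0 ^+ 2)).
rewrite -(big_add1 _ _ 0 n xpredT (fun j => Num.min (t - ostat y j) 0 ^+ 2)).
rewrite [RHS](@big_cat_nat _ _ _ i.+1)//= [X in _ = X + _]big_nat.
rewrite [X in _ = X + _]big1 ?add0r.
  apply: eq_big_nat => j /hi tj.
  by rewrite min_l// subr_le0.
move=> j /lo jt; rewrite min_r ?expr0n//.
by rewrite subr_ge0.
Qed.

Lemma pwfunE : (2 <= n)%N -> pwfun y = pwfun_closed.
Proof.
move=> n2; have n0 : (0 < n)%N by exact: ltnW.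
apply/funext => t; rewrite /pwfun_closed.
case: (pwfun_cover y t n2) => [t1|[i /andP[i0 i_n] /andP[it ti]]|nt].
- rewrite (pwfun_left t1) (sum_ostat y (fun x => (t - x) ^+ 2)).
  congr (_ + _ * _); apply: tail_sum_min => //; first by case.
  move=> j /andP[j0 jn]; apply: (le_trans t1); apply: ostat_le => //.
  by rewrite j0 ltnW.
- rewrite (@pwfun_mid _ _ _ _ i) ?i0 ?it//; congr (_ + _ * _).
  apply: tail_sum_min; first by rewrite -(prednK n0) ltnS.
    move=> j /andP[j0 ji]; apply: le_trans it; apply: ostat_le => //.
    by rewrite ji (leq_trans i_n)// leq_pred.
  move=> j /andP[ij jn]; apply: (le_trans ti); apply: ostat_le => //.
  by rewrite ij ltnW.
(* With the cut at [n - 1], the tail sum is the single term of [y_(n)]. *)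
- rewrite (pwfun_right n2 nt) -(@tail_sum_min t n.-1) ?prednK ?big_nat1//.
    move=> j /andP[j0 jn]; apply: le_trans nt; apply: ostat_le => //.
    by rewrite leqnn (leq_trans jn)// leq_pred.
  by move=> j /andP[nj]; rewrite ltnNge nj.
Qed.

Lemma is_derive_pwfun_closed (t : R) :
  is_derive t 1 pwfun_closed (pwfun_slope t).
Proof.
have d j : is_derive t 1 (fun s : R => Num.min (s - ostat y j) 0 ^+ 2)
    (2 * Num.min (t - ostat y j) 0).
  have dm := @is_derive_sqr_min0 R (t - ostat y j).
  have ds : is_derive t 1 (fun s : R => s - ostat y j) 1.
    by apply: is_derive_eq; rewrite subr0.
  have := @is_derive1_comp R (fun s : R => Num.min s 0 ^+ 2)
    (fun s : R => s - ostat y j) t _ _ dm ds.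
  by rewrite mulr1.
have dsum := @is_derive_sum _ _ _ _ _ _ _ _ (fun j : 'I_n.-1 => d j.+1).
(* Written with operations on functions, the closed form lets instance inference assemble the
   derivative from [dsum]. *)
have -> : pwfun_closed = (id + 2^-1 \*: ((id - cst (ostat y n)) ^+ 2 +
   \sum_(j < n.-1) (fun s : R => Num.min (s - ostat y j.+1) 0 ^+ 2))).
  by apply/funext => s; rewrite /pwfun_closed /= !fctE fct_sumE.
apply: is_derive_eq.
rewrite /pwfun_slope -mulr_sumr /GRing.scale /= !fctE.
by field.
Qed.

Lemma continuous_pwfun_slope : continuous pwfun_slope.
Proof.
move=> t; apply: cvgD; first exact: cvg_cst.
have cB a : (fun s : R => s - a) @ t --> t - a.
  by apply: cvgB; [exact: cvg_id|exact: cvg_cst].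
apply: cvgD; first exact: cB.
apply: cvg_big => [|j _]; first exact: add_continuous.
apply: (@continuous_min R R (fun s => s - ostat y j.+1) (cst 0)).
  exact: cB.
exact: cvg_cst.
Qed.

End closed_form.

Theorem lemma2p1 (R : realType) (n : nat) (hn : (2 <= n)%N) (y : 'cV[R]_n) :
  [/\ continuous (pwfun y),
      (forall t : R, derivable (pwfun y) t 1)
    & continuous (derive1 (pwfun y))].
Proof.
(* [pwfunE] is an equality of functions on the whole line, so no gluing at the breakpoints is
   required. *)
have d (t : R) : is_derive t 1 (pwfun y) (pwfun_slope y t).
  by rewrite pwfunE//; exact: is_derive_pwfun_closed.
split.
- by move=> t; apply: differentiable_continuous; apply/derivable1_diffP.
- by [].
- have -> : derive1 (pwfun y) = pwfun_slope y.
    by apply/funext => t; rewrite derive1E derive_val.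
  exact: continuous_pwfun_slope.
Qed.
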